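(* Consider the system of equations for $\mathbf{E}(T)=(E_1(T),\dots,E_n(T))$ $$E_i(T) = A_i^e(T)\,\mathbb{V}_i^e(E_i(T)) - L_i^e(T) + \sum_{j=1}^n A_{ij}(T)\,\mathbb{V}_{ij}(E_j(T)) - \sum_{j=1}^n L_{ij}(T),\qquad i=1,\dots,n, \qquad ( * )$$ where the valuation is performed at maturity, $t=T$. If 1. $\mathbb{V}_i^e(E_i(T))=1$ for all $i$, 2. $\mathbb{V}_{ij}(E_j(T))=\mathbf{1}_{E_j(T)\ge 0}+\left[(\alpha-\beta)\frac{A_j^e(T)}{\bar p_j(T)}+\beta\left(\frac{E_j(T)+\bar p_j(T)}{\bar p_j(T)}\right)^+\right]\mathbf{1}_{E_j(T)<0}$ for all $i,j$, where $\bar p_j(T)=L_j^e(T)+\sum_i L_{ji}(T)$, then there is a one-to-one correspondence between the solutions of $( * )$ and the solutions of the map introduced by Rogers and Veraart (2013), i.e. the clearing payment vectors $\mathbf{p}^*(T)$ such that, for every $i$, $$p_i^*(T)=\begin{cases}\bar p_i(T) & \text{if } A_i^e(T)+\sum_{j}L_{ji}(T)\frac{p_j^*(T)}{\bar p_j(T)}\ge \bar p_i(T),\\ \alpha A_i^e(T)+\beta\sum_{j}L_{ji}(T)\frac{p_j^*(T)}{\bar p_j(T)} & \text{otherwise.}\end{cases}$$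
   Context: A financial system of $n$ banks has interbank credit contracts maturing at time $T$. For each bank $i$, $A_i^e(T)$ and $L_i^e(T)$ are the book values at time $T$ of its external (non-interbank) assets and liabilities. $L_{ij}(T)$ is the book value of the liability of bank $i$ towards bank $j$, and $A_{ij}(T)$ is the book value of the interbank asset of bank $i$ towards bank $j$, with $A_{ji}(T)=L_{ij}(T)$. $E_i(T)$ is the equity valuation of bank $i$; $\mathbb{V}_i^e$ and $\mathbb{V}_{ij}$ are the external and interbank valuation functions, i.e. the ratios between the valuation and the book value of, respectively, the external assets of $i$ and the interbank asset of $i$ towards $j$. $\bar p_j(T)$ is the total liability of bank $j$. $\mathbf{1}$ denotes an indicator and $(x)^+=(x+|x|)/2$. $\alpha$ and $\beta$ are the parameters of the Rogers–Veraart model: when a bank defaults, its external assets are discounted by a factor $\alpha$ and its interbank assets by a factor $\beta$. $p_i^*(T)$ is the total payment made by bank $i$ to its counterparties.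
   Formalization: Book values are nonnegative and α, β lie in [0,1], with the case α = 0, β = 1 excluded (the claim fails there); clearing payment vectors are the fixed points of the map with 0 ≤ p_i ≤ p̄_i for every i. *)

(* Defs.v *)
From HB Require Import structures.
From mathcomp Require Import all_boot all_order all_algebra.
From mathcomp Require Import all_classical reals.

Set Implicit Arguments.
Unset Strict Implicit.
Unset Printing Implicit Defensive.

Import Order.TTheory GRing.Theory Num.Theory.

Local Open Scope classical_set_scope.
Local Open Scope ring_scope.

(* Vectors of R^n are row vectors: the i-th coordinate of E is E 0 i.
   Everything is evaluated at maturity T, so T does not appear.
   L i j is the liability of bank i towards bank j, and A i j is the interbank
   asset of bank i towards bank j. *)

Definition total_liability (R : realType) (n : nat)
    (Le : 'rV[R]_n) (L : 'M[R]_n) : 'rV[R]_n :=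
  \row_j (Le 0 j + \sum_(i < n) L j i).

Definition pos_part (R : realType) (x : R) : R := (x + `|x|) / 2.

(* Valuation, as a function of the equity x of the debtor j, of a claim on j.
   If pbar 0 j = 0 the quotients are 0, and j has no creditor. *)
Definition RV_valuation (R : realType) (n : nat) (alpha beta : R)
    (Ae pbar : 'rV[R]_n) (j : 'I_n) (x : R) : R :=
  (0 <= x)%R%:R
  + ((alpha - beta) * (Ae 0 j / pbar 0 j)
     + beta * pos_part ((x + pbar 0 j) / pbar 0 j)) * (x < 0)%R%:R.

Definition equity_solutions (R : realType) (n : nat)
    (Ae Le : 'rV[R]_n) (A L : 'M[R]_n)
    (Ve : 'I_n -> R -> R) (V : 'I_n -> 'I_n -> R -> R) : set 'rV[R]_n :=
  [set E : 'rV[R]_n | forall i : 'I_n,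
     E 0 i = Ae 0 i * Ve i (E 0 i) - Le 0 i
             + \sum_(j < n) A i j * V i j (E 0 j) - \sum_(j < n) L i j].

(* L j i * (p 0 j / pbar 0 j) is 0 when pbar 0 j = 0, which is the convention
   of Rogers and Veraart for the relative liabilities of a bank without
   liabilities. *)
Definition RV_map (R : realType) (n : nat) (alpha beta : R)
    (Ae pbar : 'rV[R]_n) (L : 'M[R]_n) (p : 'rV[R]_n) : 'rV[R]_n :=
  \row_i
    if pbar 0 i <= Ae 0 i + \sum_(j < n) L j i * (p 0 j / pbar 0 j)
    then pbar 0 i
    else alpha * Ae 0 i + beta * \sum_(j < n) L j i * (p 0 j / pbar 0 j).

(* As in Rogers and Veraart (2013), a clearing vector is a fixed point of the
   map in the box [0, pbar]. The box matters: if beta = 1 and no bank has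
   external assets, the map can also have fixed points with negative entries. *)
Definition clearing_vectors (R : realType) (n : nat) (alpha beta : R)
    (Ae pbar : 'rV[R]_n) (L : 'M[R]_n) : set 'rV[R]_n :=
  [set p : 'rV[R]_n | (forall i : 'I_n, 0 <= p 0 i <= pbar 0 i)
           /\ p = RV_map alpha beta Ae pbar L p].

(* Main.v *)
(* The maps p_j = pbar_j V_j(E_j) and E_i = A_i + sum_j L_ji p_j / pbar_j - pbar_i
   are mutually inverse once the truncation in V is inactive, that is once
   every solution E has only nonnegative valuations. For the latter, let u_j be
   the negative part of V_j(E_j). If u_j > 0, then bank j is in default with
   positive external assets, and alpha > 0 or beta < 1 forces
   pbar_j u_j < sum_k L_kj u_k. Since the liabilities L_kj of bank k sum to at
   most pbar_k, adding these inequalities over j is contradictory, so u = 0. *)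
Require Import Defs.
From HB Require Import structures.
From mathcomp Require Import all_boot all_order all_algebra.
From mathcomp Require Import all_classical reals.
From mathcomp Require Import ring lra.

Set Implicit Arguments.
Unset Strict Implicit.
Unset Printing Implicit Defensive.

Import Order.TTheory GRing.Theory Num.Theory.

Local Open Scope classical_set_scope.
Local Open Scope ring_scope.

Section PosPart.
Variable R : realType.
Implicit Types x y : R.

Lemma pos_part_ge x : x <= pos_part x.
Proof. by rewrite /pos_part; have := ler_norm x; lra. Qed.

Lemma pos_part_ge0 x : 0 <= pos_part x.
Proof. by rewrite /pos_part; have := ler_norm (- x); rewrite normrN; lra. Qed.

Lemma ger0_pos_part x : 0 <= x -> pos_part x = x.
Proof. by move=> x0; rewrite /pos_part ger0_norm //; lra. Qed.

Lemma pos_partM x y : 0 <= y -> pos_part (x * y) = pos_part x * y.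
Proof. by move=> y0; rewrite /pos_part normrM (ger0_norm y0); lra. Qed.

End PosPart.

Section Valuation.
Variables (R : realType) (n : nat) (alpha beta : R) (Ae pbar : 'rV[R]_n).
Implicit Types (j : 'I_n) (x : R).

Lemma RV_valuation_ge0 j x : 0 <= x -> RV_valuation alpha beta Ae pbar j x = 1.
Proof. by move=> x0; rewrite /RV_valuation x0 ltNge x0 mulr0 addr0. Qed.

(** Division by zero returns 0, so both quotients vanish and only the indicator of [0 <= x]
    survives. *)
Lemma RV_valuation_noliab j x :
  pbar 0 j = 0 -> 0 <= RV_valuation alpha beta Ae pbar j x.
Proof.
move=> p0; rewrite /RV_valuation p0 invr0 !mulr0 ger0_pos_part // mulr0 addr0.
by rewrite mul0r addr0 ler0n.
Qed.

(** When [x + pbar 0 j] is a nonnegative asset value [Ae 0 j + S], the right-hand side becomes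
    [alpha * Ae 0 j + beta * S], the default branch of [RV_map]. *)
Lemma RV_payment_default j x : 0 < pbar 0 j -> x < 0 ->
  pbar 0 j * RV_valuation alpha beta Ae pbar j x =
  (alpha - beta) * Ae 0 j + beta * pos_part (x + pbar 0 j).
Proof.
move=> p0 x0; rewrite /RV_valuation x0 leNgt x0 add0r mulr1.
rewrite pos_partM ?invr_ge0 ?ltW //; field.
by rewrite gt_eqF.
Qed.

End Valuation.

Lemma shortfall_eq0 (R : realType) (n : nat) (L : 'M[R]_n) (q u : 'I_n -> R) :
    (forall i j, 0 <= L i j) -> (forall k, \sum_j L k j <= q k) ->
    (forall j, 0 <= u j) ->
    (forall j, 0 < u j -> q j * u j < \sum_k L k j * u k) ->
  forall j, u j = 0.
Proof.
move=> L0 Lq u0 qu j; apply/eqP; apply: contraT => uj.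
have {}uj : 0 < u j by rewrite lt_def uj u0.
(* Indices with [u k = 0] satisfy the inequality weakly, so it can be summed over all [k]; the index
   [j] makes the sum strict. *)
have weak k : q k * u k <= \sum_i L i k * u i.
  have [uk|uk] := ltP 0 (u k); first exact/ltW/qu.
  have -> : u k = 0 by apply/le_anti; rewrite uk u0.
  by rewrite mulr0 sumr_ge0 // => i _; rewrite mulr_ge0.
have : \sum_k q k * u k < \sum_k \sum_i L i k * u i.
  rewrite (bigD1 j) //= [ltRHS](bigD1 j) //=.
  by apply: ltr_leD; [exact: qu|apply: ler_sum => k _].
rewrite exchange_big /= ltNge; apply: contraNT => _.
by apply: ler_sum => k _; rewrite -mulr_suml ler_wpM2r.
Qed.

Section Clearing.
Variables (R : realType) (n : nat) (Ae Le : 'rV[R]_n) (L : 'M[R]_n).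
Variables (alpha beta : R).
Hypothesis Ae0 : forall i, 0 <= Ae 0 i.
Hypothesis Le0 : forall i, 0 <= Le 0 i.
Hypothesis L0 : forall i j, 0 <= L i j.
Hypothesis alpha01 : 0 <= alpha <= 1.
Hypothesis beta01 : 0 <= beta <= 1.

Let pbar := total_liability Le L.
Let val := RV_valuation alpha beta Ae pbar.
Let received (p : 'rV[R]_n) i := \sum_(j < n) L j i * (p 0 j / pbar 0 j).
Let payment (E : 'rV[R]_n) : 'rV[R]_n := \row_j (pbar 0 j * val j (E 0 j)).
Let solution (E : 'rV[R]_n) :=
  forall i, E 0 i = Ae 0 i + \sum_j L j i * val j (E 0 j) - pbar 0 i.

Lemma sum_le_total_liability k : \sum_j L k j <= pbar 0 k.
Proof. by rewrite mxE lerDr. Qed.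

Lemma total_liability_ge0 k : 0 <= pbar 0 k.
Proof. by rewrite (le_trans _ (sum_le_total_liability k)) // sumr_ge0. Qed.

Lemma total_liability_eq0 k i : pbar 0 k = 0 -> L k i = 0.
Proof.
move=> pk; apply/le_anti; rewrite L0 andbT -pk.
apply: le_trans (sum_le_total_liability k).
by rewrite (bigD1 i) //= lerDl sumr_ge0.
Qed.

(** The factor [pbar 0 j] cancels unless it is 0, and then [L j i = 0] kills both terms. *)
Lemma received_payment E i :
  received (payment E) i = \sum_j L j i * val j (E 0 j).
Proof.
apply: eq_bigr => j _; rewrite mxE.
have [pj|pj] := eqVneq (pbar 0 j) 0.
  by rewrite (total_liability_eq0 i pj) !mul0r.
by rewrite [_ * val _ _]mulrC mulfK.
Qed.

Lemma received_ge0 (p : 'rV[R]_n) i : (forall j, 0 <= p 0 j) -> 0 <= received p i.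
Proof.
move=> p0; apply: sumr_ge0 => j _.
by rewrite mulr_ge0 // divr_ge0 // total_liability_ge0.
Qed.

Lemma solution_val_ge0 E : 0 < alpha \/ beta < 1 -> solution E ->
  forall j, 0 <= val j (E 0 j).
Proof.
move=> corner solE.
pose u j := Num.max 0 (- val j (E 0 j)).
have u0 j : 0 <= u j by rewrite /u le_max lexx.
suff uj0 j : u j = 0.
  move=> j; have : - val j (E 0 j) <= u j by rewrite /u le_max lexx orbT.
  by rewrite uj0 oppr_le0.
apply: (shortfall_eq0 L0 sum_le_total_liability u0) => {}j uj.
have vj : val j (E 0 j) < 0.
  by move: uj; rewrite /u lt_max ltxx /= oppr_gt0.
have -> : u j = - val j (E 0 j) by rewrite /u max_r // oppr_ge0 ltW.
set U := \sum_k _.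
have U0 : 0 <= U by apply: sumr_ge0 => k _; rewrite mulr_ge0.
have pj : 0 < pbar 0 j.
  rewrite lt_def total_liability_ge0 andbT; apply: contraTneq vj => pj.
  by rewrite -leNgt RV_valuation_noliab.
have Ej : E 0 j < 0.
  rewrite ltNge; apply: contraTN vj => Ej.
  by rewrite /val RV_valuation_ge0 // ltr10.
set S := \sum_k L k j * val k (E 0 k).
have SU : - U <= S.
  rewrite /U /S -sumrN; apply: ler_sum => k _.
  by rewrite -mulrN ler_wpM2l // lerNl /u le_max lexx orbT.
have pv := RV_payment_default alpha beta Ae pj Ej; rewrite -/val in pv.
have {solE}Ep : E 0 j + pbar 0 j = Ae 0 j + S by rewrite solE subrK.
rewrite Ep in pv.
have pvj : pbar 0 j * val j (E 0 j) < 0 by rewrite pmulr_rlt0.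
have := Ae0 j; have := pos_part_ge (Ae 0 j + S).
have := pos_part_ge0 (Ae 0 j + S); rewrite mulrN.
move: pv pvj alpha01 beta01 corner.
move: (Ae 0 j) (pos_part _) (pbar 0 j * _) => a P w -> {w} w0.
move=> /andP[al0 al1] /andP[be0 be1] corner P0 PS a0.
have bP : 0 <= beta * P by rewrite mulr_ge0.
have a_gt0 : 0 < a.
  rewrite lt_def a0 andbT; apply: contraTneq w0 => ->.
  by rewrite -leNgt mulr0 add0r.
(* Since [P >= a + S >= a - U], the payment is at least [alpha * a - beta * U]. It remains to see
   that [beta * U - alpha * a < U]: the first term of [corner] gives [alpha * a > 0], the second
   [beta * U < U]. *)
have bPS : beta * (a - U) <= beta * P by apply: ler_wpM2l => //; lra.
have aa : 0 <= alpha * a by rewrite mulr_ge0.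
case: corner => [al|be].
  have : 0 < alpha * a by rewrite mulr_gt0.
  have : beta * U <= U by rewrite ler_piMl.
  lra.
(* With [U = 0] the payment would be at least [alpha * a >= 0], contradicting [w0]. *)
have U_gt0 : 0 < U by rewrite lt_def U0 andbT; apply: contraTneq w0 => U_0; nra.
have : beta * U < U by rewrite gtr_pMl.
lra.
Qed.

Lemma solution_clearing E : 0 < alpha \/ beta < 1 -> solution E ->
  clearing_vectors alpha beta Ae pbar L (payment E).
Proof.
move=> corner solE.
have v0 := solution_val_ge0 corner solE.
have p0 j : 0 <= payment E 0 j by rewrite mxE mulr_ge0 // total_liability_ge0.
have solp i : E 0 i = Ae 0 i + received (payment E) i - pbar 0 i.
  by rewrite received_payment solE.
have pE i : payment E 0 i = RV_map alpha beta Ae pbar L (payment E) 0 i.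
  (* The solvency test of [RV_map] at [payment E] is exactly [0 <= E 0 i]. *)
  rewrite [RHS]mxE -/(received (payment E) i) -subr_ge0 -solp mxE.
  have [Ei|Ei] := leP 0 (E 0 i); first by rewrite /val RV_valuation_ge0 ?mulr1.
  have S0 := received_ge0 i p0.
  have pi : 0 < pbar 0 i by have := Ae0 i; have := solp i; lra.
  rewrite RV_payment_default // solp subrK ger0_pos_part ?addr_ge0 //; ring.
split=> [i|]; last by apply/rowP.
rewrite p0 pE mxE -/(received (payment E) i) /=.
case: ifPn => //; rewrite -ltNge => Sp.
(* In default, the discounts [alpha, beta <= 1] keep the payment below the assets, themselves below
   [pbar 0 i]. *)
apply: le_trans (ltW Sp); have [_ al1] := andP alpha01.
have [_ be1] := andP beta01.
by apply: lerD; rewrite ler_piMl ?received_ge0.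
Qed.

(** The lower bound of the box makes the receipts nonnegative, so the truncation is inactive at the
    equity built from [p]. *)
Lemma clearing_payment p : clearing_vectors alpha beta Ae pbar L p ->
  payment (\row_i (Ae 0 i + received p i - pbar 0 i)) = p.
Proof.
move=> [p01 pE]; apply/rowP => i; rewrite [RHS](congr1 (fun q : 'rV[R]_n => q 0 i) pE).
rewrite [LHS]mxE [RHS]mxE [X in val i X]mxE -/(received p i).
have S0 : 0 <= received p i by apply: received_ge0 => j; case/andP: (p01 j).
rewrite -subr_ge0; have [Ei|Ei] := leP 0.
  by rewrite /val RV_valuation_ge0 ?mulr1.
have pi : 0 < pbar 0 i by have := Ae0 i; lra.
rewrite RV_payment_default // subrK ger0_pos_part ?addr_ge0 //; ring.
Qed.

Lemma payment_bij : 0 < alpha \/ beta < 1 ->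
  set_bij [set E | solution E] (clearing_vectors alpha beta Ae pbar L) payment.
Proof.
move=> corner; split=> [E|E F|p pP].
- exact: solution_clearing.
(* The payments determine the receipts, and these determine the equity. *)
- rewrite !inE => solE solF EF; apply/rowP => i.
  by rewrite solE solF -!received_payment EF.
- have phip := clearing_payment pP.
  exists (\row_i (Ae 0 i + received p i - pbar 0 i)) => // i.
  by rewrite -received_payment phip mxE.
Qed.

End Clearing.

Theorem proposition4p2 (R : realType) (n : nat)
    (Ae Le : 'rV[R]_n) (A L : 'M[R]_n) (alpha beta : R)
    (Ve : 'I_n -> R -> R) (V : 'I_n -> 'I_n -> R -> R)
    (hAe : forall i : 'I_n, 0 <= Ae 0 i)
    (hLe : forall i : 'I_n, 0 <= Le 0 i)
    (hL : forall i j : 'I_n, 0 <= L i j)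
    (hA : forall i j : 'I_n, A j i = L i j)
    (halpha : 0 <= alpha <= 1) (hbeta : 0 <= beta <= 1)
    (* Rogers and Veraart take alpha and beta in ]0, 1]; only the corner
       alpha = 0, beta = 1, where the claim fails, has to be excluded. *)
    (hcorner : 0 < alpha \/ beta < 1)
    (hVe : forall (i : 'I_n) (x : R), Ve i x = 1)
    (hV : forall (i j : 'I_n) (x : R),
       V i j x = RV_valuation alpha beta Ae (total_liability Le L) j x) :
  exists phi : 'rV[R]_n -> 'rV[R]_n,
    set_bij (equity_solutions Ae Le A L Ve V)
            (clearing_vectors alpha beta Ae (total_liability Le L) L) phi
    /\ (forall E : 'rV[R]_n, equity_solutions Ae Le A L Ve V E ->
        forall i j : 'I_n,
          phi E 0 j = total_liability Le L 0 j * V i j (E 0 j)).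
Proof.
pose pbar := total_liability Le L.
exists (fun E => \row_j (pbar 0 j * RV_valuation alpha beta Ae pbar j (E 0 j))).
split; last by move=> E _ i j; rewrite mxE hV.
(* Bring the system to the form of [solution]: [hA] turns [A i j] into [L j i], and all liabilities
   of [i] merge into [pbar 0 i]. *)
have -> : equity_solutions Ae Le A L Ve V = [set E | forall i, E 0 i =
    Ae 0 i + \sum_j L j i * RV_valuation alpha beta Ae pbar j (E 0 j)
    - pbar 0 i].
  apply: eq_set => E; apply: eq_forall => i.
  have -> : pbar 0 i = Le 0 i + \sum_j L i j by rewrite mxE.
  rewrite hVe mulr1 (eq_bigr (fun j =>
    L j i * RV_valuation alpha beta Ae pbar j (E 0 j))); last first.
    by move=> j _; rewrite hA hV.
  by congr (_ = _); ring.
exact: payment_bij.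
Qed.
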